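(* Let $\mathcal{G}$ be a Fréchet $\widetilde{\mathbb{C}}$-module and let $\mathcal{F}$ be a locally convex topological $\widetilde{\mathbb{C}}$-module which has a web of type $\mathcal{C}$. If a $\widetilde{\mathbb{C}}$-linear map $T:\mathcal{G}\to\mathcal{F}$ has sequentially closed graph (in $\mathcal{G}\times\mathcal{F}$ with the product topology), then $T$ is continuous.
   Context: Generalized numbers: $\widetilde{\mathbb{C}}=\mathcal{E}_M/\mathcal{N}$, where $\mathcal{E}_M$ is the ring of nets $(c_\varepsilon)_\varepsilon\in\mathbb{C}^{(0,1]}$ with $|c_\varepsilon|=O(\varepsilon^{-N})$ as $\varepsilon\to0$ for some $N\in\mathbb{N}$, and $\mathcal{N}$ is the ideal of nets with $|c_\varepsilon|=O(\varepsilon^{q})$ for all $q\in\mathbb{N}$; $[(c_\varepsilon)_\varepsilon]$ denotes the class of $(c_\varepsilon)_\varepsilon$. The valuation is $\mathrm{v}(c)=\sup\{b\in\mathbb{R}: |c_\varepsilon|=O(\varepsilon^b)\text{ as }\varepsilon\to0\}$ and $|c|_{\mathrm e}=e^{-\mathrm{v}(c)}$; $\widetilde{\mathbb{C}}$ carries the topology of the ultrametric $|c-d|_{\mathrm e}$. A topological $\widetilde{\mathbb{C}}$-module is a $\widetilde{\mathbb{C}}$-module with a topology making addition and scalar multiplication $\widetilde{\mathbb{C}}\times\mathcal{G}\to\mathcal{G}$ continuous. A subset $A$ of a $\widetilde{\mathbb{C}}$-module is convex if $A+A\subseteq A$ and $[(\varepsilon^b)_\varepsilon]A\subseteq A$ for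 all $b\ge0$. A topological $\widetilde{\mathbb{C}}$-module is locally convex if it has a base of convex neighborhoods of $0$. A Fréchet $\widetilde{\mathbb{C}}$-module is a complete metrizable locally convex topological $\widetilde{\mathbb{C}}$-module. A web on a locally convex topological $\widetilde{\mathbb{C}}$-module $\mathcal{F}$ is a family $\mathcal{W}=\{C(n_1,\dots,n_k)\}$ of subsets of $\mathcal{F}$, with $k,n_1,\dots,n_k$ running through $\mathbb{N}\setminus0$, such that $\mathcal{F}=\bigcup_{n_1\ge1}C(n_1)$ and $C(n_1,\dots,n_{k-1})=\bigcup_{n_k\ge1}C(n_1,\dots,n_k)$ for all $k>1$ and all $n_1,\dots,n_{k-1}$. It is of type $\mathcal{C}$ if for every sequence $(n_k)_{k\ge1}$ in $\mathbb{N}\setminus0$ there is a sequence $(\rho_k)_{k\ge1}$ in $\mathbb{R}$ such that for all $\lambda_k\ge\rho_k$ and all $x_k\in C(n_1,\dots,n_k)$ ($k\ge1$) the series $\sum_{k=1}^\infty[(\varepsilon^{\lambda_k})_\varepsilon]x_k$ converges in $\mathcal{F}$. *)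

(* Defs.v *)
From HB Require Import structures.
From mathcomp Require Import all_boot all_order all_algebra.
From mathcomp Require Import complex generic_quotient ring_quotient.
From mathcomp Require Import all_classical all_reals.
From mathcomp Require Import topology pseudometric_normed_Zmodule.

Set Implicit Arguments.
Unset Strict Implicit.
Unset Printing Implicit Defensive.

Import GRing.Theory.

Local Open Scope classical_set_scope.
Local Open Scope ring_scope.

(* The topological modules of tvs.v are over a numDomainType, which the ring of
   generalized numbers is not. The structures below have to be declared before
   tvs.v is imported: HB would otherwise attempt, and fail, to make them inherit
   from NbhsLmodule, whose scalars form a numDomainType. *)

#[short(type="preTopologicalNzRingType")]
HB.structure Definition PreTopologicalNzRing :=
  {K of Topological K & GRing.NzRing K}.

HB.mixin Record isTopologicalModule (K : preTopologicalNzRingType) M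
    & Topological M & GRing.Lmodule K M := {
  topmod_add_continuous : continuous (fun z : M * M => z.1 + z.2) ;
  topmod_scale_continuous : continuous (fun z : K * M => z.1 *: z.2)
}.

#[short(type="topModType")]
HB.structure Definition TopologicalModule (K : preTopologicalNzRingType) :=
  {M of Topological M & GRing.Lmodule K M & isTopologicalModule K M}.

From mathcomp Require Import all_analysis.

Import Order.TTheory Num.Theory.
Import numFieldNormedType.Exports.
Import ComplexField.Normc.

Record eps_index (R : realType) :=
  EpsIndex { eps_val :> R; eps_valP : 0 < eps_val <= 1 }.

HB.instance Definition _ (R : realType) := [isSub for @eps_val R].
HB.instance Definition _ (R : realType) := [Choice of eps_index R by <:].

Lemma one_eps_index (R : realType) : 0 < (1 : R) <= 1.
Proof. by rewrite ltr01 lexx. Qed.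

HB.instance Definition _ (R : realType) :=
  isPointed.Build (eps_index R) (EpsIndex (one_eps_index R)).

(* The filter of the limits "as eps -> 0" on (0,1]: the trace on (0,1] of the
   right neighborhoods of 0. *)
Definition eps_to0 (R : realType) : set_system (eps_index R) :=
  [set A | \forall x \near (0 : R)^'+, forall e : eps_index R, e = x :> R -> A e].

Arguments eps_to0 {R}.

Global Instance eps_to0_filter (R : realType) : ProperFilter (@eps_to0 R).
Proof.
split; last first.
  split.
  - by rewrite /eps_to0/=; near=> x.
  - move=> P Q; rewrite /eps_to0/= => nP nQ; near=> x => e ex; split.
    + by move: e ex; near: x.
    + by move: e ex; near: x.
  - move=> P Q PQ; rewrite /eps_to0/=; apply: filterS => x Px e ex.
    exact/PQ/Px.
rewrite /eps_to0/= => n0.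
suff /filter_not_empty : \forall x \near (0 : R)^'+, False by [].
near=> x.
have x01 : 0 < x <= 1.
  by apply/andP; split; near: x; [exact: nbhs_right_gt|exact: nbhs_right_le].
have h : forall e : eps_index R, e = x :> R -> False by near: x.
exact: (h (EpsIndex x01)).
Unshelve. all: by end_near. Qed.

Canonical eps_to0_filterType (R : realType) :=
  FilterType (@eps_to0 R) (@filter_filter _ _ (eps_to0_filter R)).

Definition net (R : realType) := eps_index R -> R[i].

HB.instance Definition _ (R : realType) := GRing.ComNzRing.on (net R).

(* |c_eps| = O(eps^b) as eps -> 0. The modulus is normc because the norm `|_|
   of R[i] takes its values in R[i]. *)
Definition is_Oeps (R : realType) (c : net R) (b : R) : Prop :=
  (fun e => normc (c e) : R^o) =O_eps_to0 (fun e => (e : R) `^ b : R^o).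

Section is_Oeps_theory.
Context {R : realType}.
Implicit Types (c d : net R) (a b : R).

Lemma is_OepsP c b : is_Oeps c b <->
  exists2 K : R, 0 < K &
    (\forall e \near @eps_to0 R, normc (c e) <= K * (e : R) `^ b).
Proof.
rewrite /is_Oeps; split.
  move=> /eqO_exP[K K0 H]; exists K => //.
  apply: filterS H => e; rewrite ger0_norm ?ger0_norm ?powR_ge0//.
  by case: (c e) => x y; rewrite /= sqrtr_ge0.
move=> [K K0 H]; apply/eqO_exP; exists K => //.
apply: filterS H => e; rewrite ger0_norm ?ger0_norm ?powR_ge0//.
by case: (c e) => x y; rewrite /= sqrtr_ge0.
Qed.

Lemma is_Oeps_le c a b : a <= b -> is_Oeps c b -> is_Oeps c a.
Proof.
move=> ab /is_OepsP[K K0 H]; apply/is_OepsP; exists K => //.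
apply: filterS H => e /le_trans; apply.
by rewrite ler_wpM2l ?(ltW K0)// ger_powR// eps_valP.
Qed.

Lemma is_OepsD c d b : is_Oeps c b -> is_Oeps d b -> is_Oeps (c + d) b.
Proof.
move=> /is_OepsP[K K0 H] /is_OepsP[L L0 H']; apply/is_OepsP.
exists (K + L); first exact: addr_gt0.
apply: filterS2 H H' => e He He'.
by rewrite mulrDl; exact: le_trans (le_normcD _ _) (lerD He He').
Qed.

Lemma is_OepsN c b : is_Oeps c b -> is_Oeps (- c) b.
Proof.
move=> /is_OepsP[K K0 H]; apply/is_OepsP; exists K => //.
by apply: filterS H => e; rewrite [(- c) e]/(- c e) normcN.
Qed.

Lemma is_OepsM c d a b :
  is_Oeps c a -> is_Oeps d b -> is_Oeps (c * d) (a + b).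
Proof.
move=> /is_OepsP[K K0 H] /is_OepsP[L L0 H']; apply/is_OepsP.
exists (K * L); first exact: mulr_gt0.
have normc_ge0 (z : R[i]) : 0 <= normc z by case: z => x y; exact: sqrtr_ge0.
apply: filterS2 H H' => e He He'.
rewrite [(c * d) e]/(c e * d e) normcM powRD; last first.
  by apply/implyP => _; have /andP[/lt0r_neq0] := eps_valP e.
by rewrite mulrACA ler_pM.
Qed.

Lemma is_Oeps0 b : is_Oeps 0 b.
Proof.
apply/is_OepsP; exists 1 => //; apply: nearW => e.
by rewrite [X in normc X]/(0 : R[i]) normc0 mul1r powR_ge0.
Qed.

Definition eps_pow b : net R := fun e => (((e : R) `^ b)%:C)%C.

Lemma is_Oeps_pow b : is_Oeps (eps_pow b) b.
Proof.
apply/is_OepsP; exists 1 => //; apply: nearW => e.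
by rewrite /eps_pow/= expr0n/= addr0 sqrtr_sqr mul1r ger0_norm// powR_ge0.
Qed.

Lemma eps_pow0 : eps_pow 0 = 1.
Proof. by apply/funext => e; rewrite /eps_pow powRr0. Qed.

Definition moderate : {pred net R} :=
  fun c => `[< exists N : nat, is_Oeps c (- N%:R) >].

Lemma moderate_subring : subring_closed moderate.
Proof.
split => [|c d|c d].
- apply/asboolP; exists 0%N; rewrite oppr0 -eps_pow0; exact: is_Oeps_pow.
- move=> /asboolP[N HN] /asboolP[M HM]; apply/asboolP; exists (N + M)%N.
  rewrite natrD; apply: is_OepsD; last apply: is_OepsN.
    by apply: is_Oeps_le HN; rewrite lerN2 lerDl.
  by apply: is_Oeps_le HM; rewrite lerN2 lerDr.
- move=> /asboolP[N HN] /asboolP[M HM]; apply/asboolP; exists (N + M)%N.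
  by rewrite natrD opprD; exact: is_OepsM.
Qed.

HB.instance Definition _ :=
  GRing.isSubringClosed.Build (net R) moderate moderate_subring.

Lemma moderate_pow b : eps_pow b \in moderate.
Proof.
apply/asboolP; exists (Num.bound `|b|); apply: is_Oeps_le (is_Oeps_pow b).
by rewrite lerNl (le_trans (ler_norm _))// normrN; exact/ltW/archi_boundP.
Qed.

End is_Oeps_theory.

Record E_M (R : realType) :=
  ModerateNet { net_of_E_M :> net R; E_M_moderate : net_of_E_M \in @moderate R }.

HB.instance Definition _ (R : realType) := [isSub for @net_of_E_M R].
HB.instance Definition _ (R : realType) := [Choice of E_M R by <:].
HB.instance Definition _ (R : realType) :=
  [SubChoice_isSubComNzRing of E_M R by <:].

Section negligible.
Context {R : realType}.

Definition negligible : {pred E_M R} :=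
  fun c => `[< forall q : nat, is_Oeps c q%:R >].

Lemma negligible_idealr : idealr_closed negligible.
Proof.
split.
- by apply/asboolP => q; exact: is_Oeps0.
- apply/negP => /asboolP/(_ 1%N)/is_OepsP[K K0 H].
  have : \forall e \near @eps_to0 R, 1 <= K * eps_val e.
    apply: filterS H => e.
    by rewrite [X in normc X]/(1 : R[i]) normc1 powRr1// ltW//; case/andP: (eps_valP e).
  rewrite /eps_to0/=/nbhs/= => {}H.
  suff /filter_not_empty : \forall x \near (0 : R)^'+, False by [].
  near=> x.
  have x01 : 0 < x <= 1.
    by apply/andP; split; near: x; [exact: nbhs_right_gt|exact: nbhs_right_le].
  have : 1 <= K * (EpsIndex x01 : R).
    have h : forall e : eps_index R, e = x :> R -> 1 <= K * eps_val e by near: x.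
    exact: h.
  rewrite leNgt/= => /negP; apply.
  rewrite -ltr_pdivlMl// mulr1; near: x; apply: nbhs_right_lt.
  by rewrite invr_gt0.
- move=> [a ma] [c mc] [d md] /asboolP/= Hc /asboolP/= Hd; apply/asboolP => q /=.
  have /asboolP[N aN] := ma.
  apply: is_OepsD => //.
  have := is_OepsM aN (Hc (N + q)%N).
  by rewrite natrD addKr.
Unshelve. all: by end_near. Qed.

HB.instance Definition _ := isIdealr.Build (E_M R) negligible negligible_idealr.

End negligible.

(* The ring of generalized numbers E_M / N. *)
Definition gnum (R : realType) := {ideal_quot (@negligible R)}.

HB.instance Definition _ (R : realType) := GRing.ComNzRing.on (gnum R).
HB.instance Definition _ (R : realType) := EqQuotient.on (gnum R).

Section valuation.
Context {R : realType}.
Implicit Types (c d : net R) (x y z : gnum R).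
Local Open Scope ereal_scope.
Local Open Scope quotient_scope.

Definition net_val c : \bar R := ereal_sup [set b%:E | b in is_Oeps c].

(* The choice of the representative is immaterial by gvalE. *)
Definition gval x : \bar R := net_val (repr x).

(* |x|_e = e^(- v(x)), which is finite because v(x) > -oo (see gabsE). *)
Definition gabs x : R := fine (expeR (- gval x)).

Lemma net_val_ge c b : is_Oeps c b -> b%:E <= net_val c.
Proof. by move=> cb; apply: ereal_sup_ubound; exists b. Qed.

Lemma lt_net_val c b : b%:E < net_val c -> is_Oeps c b.
Proof.
move=> /ereal_sup_gt[_ [b' cb' <-]]; rewrite lte_fin => /ltW bb'.
exact: is_Oeps_le bb' cb'.
Qed.

Lemma net_val_gtNy (c : E_M R) : -oo < net_val c.
Proof.
have /asboolP[N /net_val_ge cN] := E_M_moderate c.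
exact: lt_le_trans (ltNyr _) cN.
Qed.

Lemma negligible_Oeps (c : E_M R) b : c \in negligible -> is_Oeps c b.
Proof.
move=> /asboolP/(_ (Num.bound `|b|)); apply: is_Oeps_le.
by rewrite (le_trans (ler_norm _))//; exact/ltW/archi_boundP.
Qed.

Lemma gvalE (c : E_M R) : gval (\pi_(gnum R) c) = net_val c.
Proof.
have le (d e : E_M R) : d = e %[mod (gnum R)] -> net_val d <= net_val e.
  move=> /eqP; rewrite -Quotient.idealrBE => de.
  apply: ub_ereal_sup => _ [b db <-]; apply: net_val_ge.
  rewrite -[_ e]/(\val e) -(subKr d e) rmorphB.
  by apply: is_OepsD => //; apply: is_OepsN; exact: negligible_Oeps.
by apply/eqP; rewrite eq_le !le// reprK.
Qed.

Lemma gvalP x : exists2 c : E_M R, x = \pi_(gnum R) c & gval x = net_val c.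
Proof. by exists (repr x); rewrite ?reprK. Qed.

Lemma gval_gtNy x : -oo < gval x.
Proof. exact: net_val_gtNy. Qed.

Lemma gval_min x y : mine (gval x) (gval y) <= gval (x + y)%R.
Proof.
have [c -> ->] := gvalP x; have [d -> ->] := gvalP y.
rewrite -rmorphD/= gvalE.
wlog cd : c d / net_val c <= net_val d => [H|].
  have /orP[|dc] := le_total (net_val c) (net_val d); first exact: H.
  by rewrite minC addrC; exact: H.
rewrite min_l// leNgt; apply/negP => /ereal_sup_gt[_ [b cb <-]].
have := net_val_gtNy (c + d)%R.
case E : (net_val _) => [r| |]// _; rewrite lte_fin => rb.
pose m := ((r + b) / 2)%R.
have [rm mb] : (r < m /\ m < b)%R by rewrite !midf_lt.
have cm : is_Oeps c m by exact: is_Oeps_le (ltW mb) cb.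
have dm : is_Oeps d m.
  apply: lt_net_val; apply: lt_le_trans cd.
  by apply: lt_le_trans (net_val_ge cb); rewrite lte_fin.
have := net_val_ge (is_OepsD cm dm).
by rewrite -[(_ + _)%R]/(\val (c + d)%R) /= E lee_fin leNgt rm.
Qed.

Lemma gvalN x : gval (- x)%R = gval x.
Proof.
have le (d : E_M R) : net_val d <= net_val (- d)%R.
  apply: ub_ereal_sup => _ [b db <-]; exact: net_val_ge (is_OepsN db).
have [c -> ->] := gvalP x; rewrite -rmorphN/= gvalE.
apply/eqP; rewrite eq_le le andbT.
have := le (- c)%R; rewrite [X in net_val (- \val X)%R]/=.
by rewrite [X in _ <= net_val X -> _](_ : _ = c :> net R) ?opprK//= opprK.
Qed.

Lemma gval0 : gval 0%R = +oo.
Proof.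
rewrite -(rmorph0 (\pi_(gnum R))) gvalE; apply/eqyP => A _.
exact/net_val_ge/is_Oeps0.
Qed.

Lemma gval_eqy x : gval x = +oo -> x = 0%R.
Proof.
have [c -> ->] := gvalP x => cy.
rewrite -(rmorph0 (\pi_(gnum R))); apply/eqP; rewrite -Quotient.idealrBE subr0.
by apply/asboolP => q; apply: lt_net_val; rewrite cy ltry.
Qed.

Lemma gabsE x : (gabs x)%:E = expeR (- gval x).
Proof.
rewrite /gabs fineK// ge0_fin_numE ?expeR_ge0//.
rewrite ltey expeR_eqy; have := gval_gtNy x; by case: (gval x).
Qed.

Lemma gabs0 : gabs 0%R = 0%R.
Proof. by apply: EFin_inj; rewrite gabsE gval0. Qed.

Lemma gabs0_eq0 x : gabs x = 0%R -> x = 0%R.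
Proof.
move=> x0; apply: gval_eqy; have /eqP := gabsE x.
by rewrite x0 eq_sym expeR_eq0; case: (gval x).
Qed.

Lemma gabs_ge0 x : (0 <= gabs x)%R.
Proof. by rewrite fine_ge0// expeR_ge0. Qed.

Lemma gabsN x : gabs (- x)%R = gabs x.
Proof. by rewrite /gabs gvalN. Qed.

Lemma gabs_max x y : (gabs (x + y) <= Num.max (gabs x) (gabs y))%R.
Proof.
rewrite le_max -!lee_fin !gabsE !lee_expeR !leeN2.
by have := gval_min x y; rewrite ge_min.
Qed.

End valuation.

Section gnum_topology.
Context {R : realType}.
Implicit Types x y z : gnum R.

Let dist x y : R := gabs (x - y).

Let distxx x : dist x x = 0.
Proof. by rewrite /dist subrr gabs0. Qed.

Let dist_positivity x y : dist x y = 0 -> x = y.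
Proof. by move=> /gabs0_eq0 /eqP; rewrite subr_eq0 => /eqP. Qed.

Let dist_sym x y : dist x y = dist y x.
Proof. by rewrite /dist -gabsN opprB. Qed.

Let dist_triangle y x z : dist x z <= dist x y + dist y z.
Proof.
rewrite /dist -[x - z](subrKA y); apply: le_trans (gabs_max _ _) _.
by rewrite ge_max lerDl lerDr !gabs_ge0.
Qed.

HB.instance Definition _ := isMetric.Build R (gnum R)
  distxx dist_positivity dist_sym dist_triangle.

End gnum_topology.

(* [(eps^b)_eps] *)
Definition gpow (R : realType) (b : R) : gnum R :=
  (\pi_(gnum R) (ModerateNet (moderate_pow b)))%qT.

Definition gconvex (R : realType) (G : lmodType (gnum R)) (A : set G) : Prop :=
  [set x + y | x in A & y in A] `<=` A /\
  forall b : R, 0 <= b -> [set gpow b *: x | x in A] `<=` A.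

Definition locally_gconvex (R : realType) (G : topModType (gnum R)) : Prop :=
  forall U : set G, nbhs 0 U ->
    exists V : set G, [/\ nbhs 0 V, gconvex V & V `<=` U].

Definition metrizable (R : realType) (X : topologicalType) : Prop :=
  exists d : X -> X -> R,
    [/\ forall x y, d x y = 0 <-> x = y,
        forall x y, d x y = d y x,
        forall x y z, d x z <= d x y + d y z &
        forall x : X, nbhs x = filter_from [set r : R | 0 < r]
                                 (fun r => [set y | d x y < r])].

(* Completeness refers to the uniformity of the additive topological group. *)
Definition cauchy_filter (R : realType) (G : topModType (gnum R))
    (F : set_system G) : Prop :=
  forall U : set G, nbhs 0 U ->
    exists2 A : set G, F A & [set x - y | x in A & y in A] `<=` U.

Definition complete_gmod (R : realType) (G : topModType (gnum R)) : Prop :=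
  forall F : set_system G, ProperFilter F -> cauchy_filter F ->
    exists x : G, F --> x.

Definition frechet_gmod (R : realType) (G : topModType (gnum R)) : Prop :=
  [/\ complete_gmod G, metrizable R G & locally_gconvex G].

(* C(n_1, .., n_k) is [C [:: n_1; ..; n_k]]; only the values at nonempty
   sequences of positive integers matter. *)
Definition is_web (R : realType) (G : topModType (gnum R)) (C : seq nat -> set G) :
    Prop :=
  [set: G] = \bigcup_(n in [set n | (0 < n)%N]) C [:: n] /\
  forall s : seq nat, s != [::] -> all (fun n => 0 < n)%N s ->
    C s = \bigcup_(n in [set n | (0 < n)%N]) C (rcons s n).

Definition web_type_C (R : realType) (G : topModType (gnum R))
    (C : seq nat -> set G) : Prop :=
  forall n : nat -> nat, (forall k, (1 <= k)%N -> (0 < n k)%N) ->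
  exists rho : nat -> R,
  forall (lambda : nat -> R) (x : nat -> G),
    (forall k, (1 <= k)%N -> rho k <= lambda k) ->
    (forall k, (1 <= k)%N -> C [seq n i | i <- iota 1 k] (x k)) ->
  exists s : G,
    (fun N => \sum_(1 <= k < N.+1) gpow (lambda k) *: x k) @ \oo --> s.

Definition has_web_type_C (R : realType) (G : topModType (gnum R)) : Prop :=
  exists C : seq nat -> set G, is_web C /\ web_type_C C.

Definition seq_closed (X : topologicalType) (A : set X) : Prop :=
  forall (u : nat -> X) (l : X), (forall n, A (u n)) -> u @ \oo --> l -> A l.

Definition graph (X Y : Type) (f : X -> Y) : set (X * Y) :=
  [set z | z.2 = f z.1].

(* Main.v *)
Require Import Defs.
From HB Require Import structures.
From mathcomp Require Import all_boot all_order all_algebra.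
From mathcomp Require Import complex.
From mathcomp Require Import all_classical all_reals all_analysis.

Import Order.TTheory GRing.Theory Num.Theory.
Local Open Scope classical_set_scope.
Local Open Scope ring_scope.

(** The theorem is a gliding-hump argument in the style of De Wilde.

    Write [C k] for the web sets [C(n_1, .., n_k)] along a branch. Since [G] is
    complete and metrizable, it is not meager in itself
    ([complete_metrizable_nonmeager]), and a countable union of meager sets is
    meager, so there is a branch all of whose preimages under [T] are nonmeager
    ([web_nonmeager_branch]). The type of the web attaches to this branch
    scalars [a k], which are powers of eps, such that [\sum_k a k *: x k]
    converges in [F] for every choice of [x k] in [C k]
    ([web_type_C_summable]).

    Two consequences are played against each other. In [F], the terms of a
    convergent series tend to 0, uniformly in the choice of [x k], so that
    every neighborhood [V] of 0 contains all [a k *: C k] from some rank [m] on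
    ([summable_blocks_small]). In [G], the nonmeager set [T^-1 (C k)] has a
    point [y k] in the interior of its closure; as [a k] is invertible, the
    closure of [S k = a k *: (T^-1 (C k) - y k)] is a neighborhood of 0
    ([scaled_translate_dense]).

    Take [V] closed under subtraction, which local convexity permits
    ([gconvex_symmetric_nbhs]). A point [u] of the closure of [S m] is
    approximated by an element of [S m], up to an error that lies in the closure
    of [S m.+1] and in a small neighborhood of 0; this error is approximated
    within [S m.+1], and so on. Hence [u] is the sum of a series with terms in
    the [S k]. Its image under [T] is the difference of two series of the type
    that the web makes convergent, so the closedness of the graph identifies
    [T u] with the sum of the image series. The terms of the latter lie in [V],
    and [V], being an open subgroup, is closed: thus [T u] is in [V], and [T] is
    continuous at 0 ([closed_graph_nbhs]). *)

Set Implicit Arguments.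
Unset Strict Implicit.

(** * Meager sets *)

Section category.
Context {X : topologicalType}.
Implicit Types A B : set X.

Definition nowhere_dense A := (closure A)^° = set0.

Definition meager A := exists2 N : nat -> set X,
  (forall i, nowhere_dense (N i)) & A `<=` \bigcup_i N i.

Lemma meager_bigcup (A : nat -> set X) :
  (forall n, meager (A n)) -> meager (\bigcup_n A n).
Proof.
move=> mA.
have /choice[N NP] : forall n, exists N : nat -> set X,
    (forall i, nowhere_dense (N i)) /\ A n `<=` \bigcup_i N i.
  by move=> n; have [N ? ?] := mA n; exists N.
have nd0 : nowhere_dense set0 by rewrite /nowhere_dense closure0 interior0.
(* [unpickle] is partial: the codes of no pair contribute the empty set. *)
exists (fun i => if unpickle i is Some (n, j) then N n j else set0).
  by move=> i; case: unpickle => [[n j]|//]; exact: (NP n).1.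
move=> x [n _ /(NP n).2[j _ Nx]]; exists (pickle (n, j)) => //.
by rewrite pickleK.
Qed.

Lemma meager_sub A B : A `<=` B -> meager B -> meager A.
Proof. by move=> AB [N nN BN]; exists N => //; exact: subset_trans BN. Qed.

(** The interior of [closure A] is nonempty because [A] is not nowhere dense;
    being an open set that meets [closure A], it also meets [A]. *)
Lemma nonmeager_somewhere_dense A :
  ~ meager A -> exists2 x, A x & (closure A)^° x.
Proof.
move=> nmA; have [z cz] : exists z, (closure A)^° z.
  apply: contrapT => nz; apply: nmA.
  exists (fun=> A) => [_|x Ax]; last by exists 0%N.
  by rewrite /nowhere_dense -subset0 => z cz; apply: nz; exists z.
have [x [Ax cx]] : A `&` (closure A)^° !=set0.
  apply: (interior_subset cz); apply: open_nbhs_nbhs; split => //.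
  exact: open_interior.
by exists x.
Qed.

End category.

(** * Topological modules *)

Section topmod.
Context {K : preTopologicalNzRingType} {M : topModType K}.
Implicit Types (x y : M) (U V A : set M).

Lemma topmod_cvgD (I : Type) (F : set_system I) {FF : Filter F} (f g : I -> M) x y :
  f @ F --> x -> g @ F --> y -> (fun i => f i + g i) @ F --> x + y.
Proof.
by apply: continuous2_cvg; exact: (@topmod_add_continuous K M (x, y)).
Qed.

Lemma topmod_cvgZ (I : Type) (F : set_system I) {FF : Filter F} (a : K)
    (f : I -> M) x :
  f @ F --> x -> (fun i => a *: f i) @ F --> a *: x.
Proof.
apply: continuous2_cvg; last exact: cvg_cst.
exact: (@topmod_scale_continuous K M (a, x)).
Qed.

Lemma topmod_cvgB (I : Type) (F : set_system I) {FF : Filter F} (f g : I -> M) x y :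
  f @ F --> x -> g @ F --> y -> (fun i => f i - g i) @ F --> x - y.
Proof.
move=> fx gy; rewrite -[- y]scaleN1r.
under eq_fun do rewrite -[- g _]scaleN1r.
by apply: topmod_cvgD => //; exact: topmod_cvgZ.
Qed.

Lemma nbhs0_shift x A : nbhs x A -> nbhs 0 [set w | A (x + w)].
Proof.
have : (fun w => x + w) @ (0 : M) --> x + 0.
  by apply: topmod_cvgD; [exact: cvg_cst|exact: cvg_id].
by rewrite addr0; apply.
Qed.

Lemma nbhs_shift0 x A : nbhs 0 A -> nbhs x [set y | A (y - x)].
Proof.
have : (fun y => y - x) @ x --> x - x.
  by apply: topmod_cvgB; [exact: cvg_id|exact: cvg_cst].
by rewrite subrr; apply.
Qed.

Lemma nbhs0_sub_shrink U : nbhs 0 U ->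
  exists2 W, nbhs 0 W & forall x y, W x -> W y -> U (x - y).
Proof.
move=> U0.
have : (fun z : M * M => z.1 - z.2) @ ((0 : M), (0 : M)) --> (0 - 0 : M).
  by apply: topmod_cvgB; [exact: cvg_fst|exact: cvg_snd].
rewrite subr0 => /(_ _ U0)[[A B]/= [A0 B0] AB].
exists (A `&` B); first exact: filterI.
by move=> x y [Ax _] [_ By]; exact: (AB (x, y)).
Qed.

(** The inductive step of Baire's theorem. The condition on [closure O'] makes
    limit points of a nested sequence stay inside all its members, and the one
    on [B] makes such a sequence a Cauchy filter base. *)
Lemma open_refine (O N B : set M) : open O -> O !=set0 -> nowhere_dense N ->
  nbhs 0 B ->
  exists O', [/\ open O', O' !=set0, closure O' `<=` O, O' `&` N = set0 &
                 [set x - y | x in O' & y in O'] `<=` B].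
Proof.
move=> oO O0 nN B0.
have [z [Oz nz]] : exists z, O z /\ ~ closure N z.
  apply: contrapT => H; have [z Oz] := O0.
  suff : (closure N)^° z by rewrite nN.
  apply: (@filterS _ _ _ O) => [y Oy|]; last exact: open_nbhs_nbhs.
  by apply: contrapT => ny; apply: H; exists y.
have Q0 : nbhs 0 [set w | (O `&` ~` closure N) (z + w)].
  apply: nbhs0_shift; apply: filterI; first exact: open_nbhs_nbhs.
  by apply: open_nbhs_nbhs; split => //; exact/closed_openC/closed_closure.
have [W W0 WW] := nbhs0_sub_shrink (filterI Q0 B0).
have Wz : nbhs z [set y | W (y - z)] by exact: nbhs_shift0.
exists ([set y | W (y - z)]^°); split.
- exact: open_interior.
- by exists z.
- move=> y cy.
  have Wy : nbhs y [set t | W (t - y)] by exact: nbhs_shift0.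
  have [t [/interior_subset/= Wtz Wty]] := cy _ Wy.
  have [[+ _] _] := WW _ _ Wtz Wty.
  by rewrite opprB [t - z + _]addrC subrKA addrC subrK.
- rewrite -subset0 => y [/interior_subset/= Wy Ny].
  have [[_ +] _] := WW _ _ Wy (nbhs_singleton W0).
  by rewrite subr0 addrC subrK; apply; exact: subset_closure.
- move=> _ [x /interior_subset/= Wx [y /interior_subset/= Wy <-]].
  have [_ +] := WW _ _ Wx Wy.
  by rewrite opprB subrKA.
Qed.

(** The affine map [d |-> a *: (d - y)] is a homeomorphism, since [a] is
    invertible, and sends a point [y] of the interior of [closure D] to 0. *)
Lemma scaled_translate_dense (D : set M) (a b : K) :
  a * b = 1 -> ~ meager D ->
  exists2 y, D y & nbhs 0 (closure [set a *: (d - y) | d in D]).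
Proof.
move=> ab /nonmeager_somewhere_dense[y Dy cy]; exists y => //.
have : (fun w => y + b *: w) @ (0 : M) --> y + b *: 0.
  by apply: topmod_cvgD; [exact: cvg_cst|apply: topmod_cvgZ; exact: cvg_id].
rewrite scaler0 addr0 => g0.
have : nbhs 0 [set w | closure D (y + b *: w)] by exact: g0 _ cy.
apply: filterS => w /= cw B Bw.
have : (fun d => a *: (d - y)) @ (y + b *: w) --> a *: (y + b *: w - y).
  by apply: topmod_cvgZ; apply: topmod_cvgB; [exact: cvg_id|exact: cvg_cst].
rewrite addrAC subrr add0r scalerA ab scale1r => fw.
have [d [Dd Bd]] := cw _ (fw _ Bw).
by exists (a *: (d - y)); split => //; exists d.
Qed.

End topmod.

Section generalized_modules.
Context {R : realType}.

Lemma gpowMN (b : R) : gpow b * gpow (- b) = 1.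
Proof.
rewrite /gpow -rmorphM/= -(rmorph1 (\pi_(gnum R)%qT)).
congr (\pi_(gnum R)%qT _); apply/val_inj/funext => e /=.
have e0 : eps_val e != 0 by have /andP[/lt0r_neq0] := eps_valP e.
apply: (etrans (esym (rmorphM (real_complex R) _ _))).
by rewrite -powRD ?subrr ?powRr0 ?rmorph1// e0 implybT.
Qed.

(** The base obtained is eventually contained in each neighborhood, so that a
    sequence with [i]-th term in [B i] converges. *)
Lemma metrizable_countable_base (X : topologicalType) (x : X) :
  metrizable R X ->
  exists2 B : nat -> set X, (forall i, nbhs x (B i)) &
    forall U, nbhs x U -> exists k, forall i, (k <= i)%N -> B i `<=` U.
Proof.
case=> d [_ _ _ dn]; exists (fun i => [set y | d x y < i.+1%:R^-1]).
  by move=> i; rewrite dn; exists i.+1%:R^-1 => //=; rewrite invr_gt0 ltr0n.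
move=> U; rewrite dn => -[r /= r0 rU].
have [k _ kr] := near_infty_natSinv_lt (PosNum r0).
by exists k => i ki y /= dy; apply: rU => /=; exact: lt_trans dy (kr _ ki).
Qed.

(** Baire's theorem. The metric supplies a countable base at 0, whereas
    completeness is that of the additive group: the nested sets are made small
    by their differences and not by their diameters. *)
Lemma complete_metrizable_nonmeager (M : topModType (gnum R)) :
  complete_gmod M -> metrizable R M -> ~ meager [set: M].
Proof.
move=> cM /(metrizable_countable_base 0)[B B0 Bbase] [N nN MN].
pose ok (O : set M) := open O /\ O !=set0.
have step (i : nat) (O : set M) : exists O', ok O ->
    [/\ ok O', closure O' `<=` O, O' `&` N i = set0 &
        [set x - y | x in O' & y in O'] `<=` B i].
  have [[oO O0]|nO] := pselect (ok O); last by exists O.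
  by have [P [oP P0 clP PN PB]] := open_refine oO O0 (nN i) (B0 i); exists P.
have [f fP] := choice (fun p : nat * set M => step p.1 p.2).
pose O := fix O k := if k is j.+1 then f (j, O j) else [set: M].
have okO k : ok (O k).
  elim: k => [|k IH]; last by have [] := fP (k, O k) IH.
  by split; [exact: openT|exists 0].
have OS k := fP (k, O k) (okO k).
have Odec i j : (i <= j)%N -> O j `<=` O i.
  move/subnK <-; elim: (j - i)%N => [//|k IH]; rewrite addSn.
  have [_ + _ _] := OS (k + i)%N => cO.
  by apply: subset_trans IH; apply: subset_trans cO; exact: subset_closure.
pose FO := filter_from [set: nat] O.
have FOF : ProperFilter FO.
  apply: filter_from_proper; last by move=> i _; exact: (okO i).2.
  apply: filter_from_filter; first by exists 0%N.
  move=> i j _ _; exists (maxn i j) => //.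
  by rewrite subsetI; split; apply: Odec; rewrite ?leq_maxl ?leq_maxr.
have [x Fx] : exists x : M, FO --> x.
  apply: cM => U /Bbase[k kU]; exists (O k.+1); first by exists k.+1.
  by apply: subset_trans (kU k (leqnn k)); have [] := OS k.
have clx k : closure (O k) x.
  move=> V /Fx[j _ OV].
  have [z Oz] := (okO (maxn k j)).2.
  by exists z; split; [|apply: OV]; apply: Odec Oz; rewrite ?leq_maxl ?leq_maxr.
(* [O i.+1] avoids [N i], yet contains [x], which adheres to [O i.+2]. *)
have [i _ Nx] := MN x I.
have [_ _ + _] := OS i; rewrite -subset0; apply; split; last exact: Nx.
by have [_ + _ _] := OS i.+1; apply; exact: (clx i.+2).
Qed.

(** * Webs *)

(** A nonmeager preimage of a web set is the countable union of the preimages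
    of its children, so one of these is nonmeager. *)
Lemma web_nonmeager_branch (G : topologicalType) (F : topModType (gnum R))
    (T : G -> F) (C : seq nat -> set F) :
  ~ meager [set: G] -> is_web C ->
  exists2 n : nat -> nat, (forall k, (1 <= k)%N -> (0 < n k)%N) &
    forall k, ~ meager (T @^-1` C [seq n i | i <- iota 1 k.+1]).
Proof.
move=> nmG [C1 CS].
(* With the whole space at the root, both clauses of [is_web] become one. *)
pose C' s := if s is [::] then [set: F] else C s.
have C'S s : all (fun n => 0 < n)%N s ->
    C' s = \bigcup_(n in [set n | (0 < n)%N]) C' (rcons s n).
  by case: s => [|m s] s0; [exact: C1|exact: CS].
have step s : exists n, all (fun n => 0 < n)%N s -> ~ meager (T @^-1` C' s) ->
    (0 < n)%N /\ ~ meager (T @^-1` C' (rcons s n)).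
  have [[s0 nms]|] := pselect (all (fun n => 0 < n)%N s /\ ~ meager (T @^-1` C' s)).
    apply: contrapT => H; apply: nms; rewrite C'S// preimage_bigcup.
    apply: (@meager_sub _ _ (\bigcup_n (T @^-1` C' (rcons s n.+1)))).
      by move=> x [[//|n] _ Tx]; exists n.
    apply: meager_bigcup => n; apply: contrapT => nm.
    by apply: H; exists n.+1.
  by move=> ns; exists 0%N => s0 nms; case: ns.
have [next nextP] := choice step.
pose s k := iter k (fun s => rcons s (next s)) [::].
have sP k : all (fun n => 0 < n)%N (s k) /\ ~ meager (T @^-1` C' (s k)).
  elim: k => [//|k [s0 nms]]; have [n0 ?] := nextP _ s0 nms.
  by split => //=; rewrite all_rcons n0.
exists (fun k => next (s k.-1)) => [[//|k] _|k].
  by have [s0 nms] := sP k; have [] := nextP _ s0 nms.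
have -> : [seq next (s i.-1) | i <- iota 1 k.+1] = s k.+1.
  rewrite (iotaDl 1 0) -map_comp; elim: k.+1 => [//|j IH].
  have -> : iota 0 j.+1 = rcons (iota 0 j) j by rewrite -addn1 iotaD cats1.
  by rewrite map_rcons IH.
have := (sP k.+1).2; suff -> : C' (s k.+1) = C (s k.+1) by [].
by rewrite /=; case: (s k).
Qed.

Section summable.
Context {F : topModType (gnum R)}.

(** The property of the web sets along one branch that the closed graph
    argument depends on, with blocks indexed from 0. *)
Definition summable_blocks (D : nat -> set F) (a : nat -> gnum R) :=
  forall x : nat -> F, (forall k, D k (x k)) ->
    exists s : F, (fun N => \sum_(k < N) a k *: x k) @ \oo --> s.

(** If the conclusion failed for infinitely many [k], choosing for these [k] a
    counterexample would give a convergent series whose terms do not tend to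
    0. *)
Lemma summable_blocks_small D a (V : set F) :
  (forall k, D k !=set0) -> summable_blocks D a -> nbhs 0 V ->
  exists m, forall k x, (m <= k)%N -> D k x -> V (a k *: x).
Proof.
move=> D0 sD V0.
have /choice[x xP] : forall k, exists x, D k x /\
    ((exists2 y, D k y & ~ V (a k *: y)) -> ~ V (a k *: x)).
  move=> k; have [[y Dy nVy]|nex] := pselect (exists2 y, D k y & ~ V (a k *: y)).
    by exists y.
  by have [y Dy] := D0 k; exists y.
have [s ss] := sD x (fun k => (xP k).1).
have : (fun N => \sum_(k < N.+1) a k *: x k - \sum_(k < N) a k *: x k) @ \oo
    --> s - s.
  apply: topmod_cvgB => // W /ss[p _ pW].
  by exists p => // N pN; apply: pW; exact: leqW.
rewrite subrr => /(_ _ V0)[m _ mV]; exists m => k y mk Dy.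
apply: contrapT => nVy; apply: ((xP k).2); first by exists y.
by have := mV k mk; rewrite /= big_ord_recr/= addrAC subrr add0r.
Qed.

Lemma web_type_C_summable (C : seq nat -> set F) (n : nat -> nat) :
  web_type_C C -> (forall k, (1 <= k)%N -> (0 < n k)%N) ->
  exists rho : nat -> R,
    summable_blocks (fun k => C [seq n i | i <- iota 1 k.+1])
                    (fun k => gpow (rho k)).
Proof.
move=> CC /CC[rho rhoP]; exists (fun k => rho k.+1) => x Dx.
have [||s ss] := rhoP rho (fun k => x k.-1); first by move=> k _; exact: lexx.
  by case.
exists s; move: ss; under eq_fun do rewrite big_add1 big_mkord.
exact.
Qed.

(** Convexity in the present sense already contains stability under addition,
    so intersecting with the opposite set gives an additive subgroup. *)
Lemma gconvex_symmetric_nbhs (V : set F) : gconvex V -> nbhs 0 V ->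
  exists V', [/\ nbhs 0 V', V' `<=` V & forall x y, V' x -> V' y -> V' (x - y)].
Proof.
move=> [VD _] V0; exists [set x | V x /\ V (- x)]; split.
- apply: filterI => //.
  have : (fun x : F => 0 - x) @ (0 : F) --> (0 - 0 : F).
    by apply: topmod_cvgB; [exact: cvg_cst|exact: cvg_id].
  rewrite subr0 => opp0.
  have NV0 : nbhs 0 [set x : F | V (0 - x)] by exact: opp0 _ V0.
  by apply: filterS NV0 => x /=; rewrite sub0r.
- by move=> x [].
- move=> x y [Vx VNx] [Vy VNy]; split; apply: VD.
    by exists x => //; exists (- y).
  by rewrite opprB addrC; exists (- x) => //; exists y.
Qed.

End summable.

(** * The closed graph theorem *)

Section closed_graph.
Context {G F : topModType (gnum R)} (T : {linear G -> F}).

(** The approximation argument: every point of [U m], a neighborhood of 0, is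
    the sum of a series [\sum_k a k *: (x k - y k)] with [x k] and [y k] in
    [T^-1 (D k)], whose image lies in [V]. *)
Lemma closed_graph_nbhs (D : nat -> set F) (a : nat -> gnum R) (V : set F) :
  metrizable R G -> seq_closed (graph T) ->
  (forall k, exists b, a k * b = 1) ->
  (forall k, ~ meager (T @^-1` D k)) ->
  summable_blocks D a ->
  nbhs 0 V -> (forall x y, V x -> V y -> V (x - y)) ->
  nbhs 0 (T @^-1` V).
Proof.
move=> /(metrizable_countable_base 0)[B B0 Bbase] hT aunit nmD sD V0 VB.
have VV : V 0 by exact: nbhs_singleton.
have VD x y : V x -> V y -> V (x + y).
  by move=> Vx Vy; rewrite -[y]opprK -[- y]sub0r; apply: (VB) => //; apply: VB.
have /choice[y yP] : forall k, exists y, D k (T y) /\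
    nbhs 0 (closure [set a k *: (d - y) | d in T @^-1` D k]).
  move=> k; have [b ab] := aunit k.
  by have [y ? ?] := scaled_translate_dense ab (nmD k); exists y.
pose S k := [set a k *: (d - y k) | d in T @^-1` D k].
pose U k := closure (S k) `&` B k.
have U0 k : nbhs 0 (U k) by apply: filterI => //; exact: (yP k).2.
have [m mV] : exists m, forall k x, (m <= k)%N -> D k x -> V (a k *: x).
  apply: summable_blocks_small sD V0 => k; exists (T (y k)); exact: (yP k).1.
apply: filterS (U0 m) => u Uu.
(* The pair [p] is a rank with the remainder left at that rank. Below rank [m]
   nothing is subtracted, so that the sums can start at 0 and the summability
   hypothesis applies as it is. *)
have step (p : nat * G) : exists d, [/\ D p.1 (T d),
    V (T (a p.1 *: (d - y p.1))),
    (p.1 < m)%N -> d = y p.1 &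
    (m <= p.1)%N -> U p.1 p.2 -> U p.1.+1 (p.2 - a p.1 *: (d - y p.1))].
  case: p => k w /=; have [km|mk] := ltnP k m.
    by exists (y k); split => //; [exact: (yP k).1|rewrite subrr scaler0 linear0].
  have VT d : D k (T d) -> V (T (a k *: (d - y k))).
    move=> Dd; rewrite linearZ/= linearB/= scalerBr; apply: VB; apply: mV => //.
    exact: (yP k).1.
  have [[cw _]|nU] := pselect (U k w); last first.
    by exists (y k); split => //; [exact: (yP k).1|apply: VT; exact: (yP k).1].
  have : nbhs w [set z | U k.+1 (w - z)].
    have : (fun z => w - z) @ w --> w - w.
      by apply: topmod_cvgB; [exact: cvg_cst|exact: cvg_id].
    by rewrite subrr; apply; exact: U0.
  by move=> /cw[_ [[d Dd <-] Ud]]; exists d; split => //; exact: VT.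
have [e eP] := choice step.
(* [r k] is the remainder before step [k]. *)
pose r := fix r k := if k is j.+1 then r j - a j *: (e (j, r j) - y j) else u.
pose x k := e (k, r k).
have rm k : (k <= m)%N -> r k = u.
  elim: k => [//|k IH km] /=; have [_ _ /(_ km) /= -> _] := eP (k, r k).
  by rewrite subrr scaler0 subr0 IH// ltnW.
have rU k : (m <= k)%N -> U k (r k).
  move/subnK <-; elim: (k - m)%N => [|j IH]; first by rewrite add0n rm.
  rewrite addSn; have [_ _ _ /= + ] := eP ((j + m)%N, r (j + m)%N).
  by apply => //; exact: leq_addl.
have rE N : \sum_(k < N) a k *: (x k - y k) = u - r N.
  elim: N => [|N IH]; first by rewrite big_ord0 subrr.
  by rewrite big_ord_recr/= IH opprB addrA addrAC.
have r0 : r @ \oo --> (0 : G).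
  move=> W /Bbase[k kW]; exists (maxn k m) => // i /=.
  rewrite geq_max => /andP[ki mi]; apply: (kW i ki).
  by have [] := rU i mi.
have Gcvg : (fun N => \sum_(k < N) a k *: (x k - y k)) @ \oo --> u.
  under eq_fun do rewrite rE.
  have : (fun N => u - r N) @ \oo --> u - 0.
    by apply: topmod_cvgB => //; exact: cvg_cst.
  by rewrite subr0.
have Dx k : D k (T (x k)) by have [] := eP (k, r k).
have [s ss] := sD _ Dx.
have [s' ss'] := sD _ (fun k => (yP k).1).
have Fcvg : (fun N => T (\sum_(k < N) a k *: (x k - y k))) @ \oo --> s - s'.
  have -> : (fun N => T (\sum_(k < N) a k *: (x k - y k))) =
      (fun N => \sum_(k < N) a k *: T (x k) - \sum_(k < N) a k *: T (y k)).
    apply/funext => N; rewrite linear_sum -sumrB; apply: eq_bigr => k _.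
    by rewrite linearZ/= linearB/= scalerBr.
  exact: topmod_cvgB.
have -> : (T @^-1` V) u = V (s - s').
  congr V; symmetry.
  apply: (hT (fun N => (\sum_(k < N) a k *: (x k - y k),
    T (\sum_(k < N) a k *: (x k - y k)))) (u, s - s')) => //.
  exact: cvg_pair.
(* The limit differs by an element of [V] from a partial sum, itself in [V]. *)
have [N _ /(_ N (leqnn N))/=] := Fcvg _ (nbhs_shift0 (s - s') V0).
set t := T _ => Vt.
have -> : s - s' = t - (t - (s - s')) by rewrite subKr.
apply: VB => //; rewrite /t linear_sum.
elim/big_rec: _ => // k z _ Vz; apply: VD => //.
by have [] := eP (nat_of_ord k, r k).
Qed.

End closed_graph.
End generalized_modules.

Theorem theorem1p6 (R : realType) (G F : topModType (gnum R))
    (hG : frechet_gmod G)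
    (hF : locally_gconvex F)
    (hW : has_web_type_C F)
    (T : {linear G -> F})
    (hT : seq_closed (graph T)) :
  continuous T.
Proof.
have [cG mG _] := hG; have [C [webC typeC]] := hW.
have [n n0 nmn] := web_nonmeager_branch T
  (complete_metrizable_nonmeager cG mG) webC.
have [rho sC] := web_type_C_summable typeC n0.
move=> x A; rewrite /nbhs/= => /nbhs0_shift/hF[V [V0 cV VA]].
have [V' [V'0 V'V V'B]] := gconvex_symmetric_nbhs cV V0.
have TV : nbhs 0 (T @^-1` V').
  apply: closed_graph_nbhs sC V'0 V'B => //.
  by move=> k; exists (gpow (- rho k)); exact: gpowMN.
apply: filterS (nbhs_shift0 x TV) => y /= /V'V/VA/=.
by rewrite -linearD/= addrC subrK.
Qed.
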